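(* Let $X$ be a topological space and let $\mathcal I$ be an ideal of compact Hausdorff subspaces of $X$. For any rectifiable space $Y$ the function space $C_{\mathcal I}(X,Y)$ is rectifiable and hence is continuously homogeneous.
   Context: A topological space $X$ is rectifiable if there are a point $e\in X$ and a homeomorphism $H:X^2\to X^2$ such that $H(x,e)=(x,x)$ and $H(\{x\}\times X)=\{x\}\times X$ for every $x\in X$. A topological space $X$ is continuously homogeneous if there exists a homeomorphism $H:X^3\to X^3$ such that $H(x,y,x)=(x,y,y)$ and $H(\{(x,y)\}\times X)=\{(x,y)\}\times X$ for any points $x,y\in X$. A family $\mathcal I$ of compact subsets of a topological space $X$ is an ideal of compact subsets if $\bigcup\mathcal I=X$ and for any $A,B\in\mathcal I$ and any compact subset $K\subset X$ we have $A\cup B\in\mathcal I$ and $A\cap K\in\mathcal I$; it is an ideal of compact Hausdorff subspaces if moreover every member of $\mathcal I$ is Hausdorff in the subspace topology. $C_{\mathcal I}(X,Y)$ denotes the set of all continuous functions from $X$ to $Y$ with the topology generated by the subbase consisting of the sets $[K;U]=\{f: f(K)\subset U\}$, where $K\in\mathcal I$ and $U\subset Y$ is open. *)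

(* Defs.v *)
From HB Require Import structures.
From mathcomp Require Import all_boot all_classical.
From mathcomp Require Import topology.

Set Implicit Arguments.
Unset Strict Implicit.
Unset Printing Implicit Defensive.

Local Open Scope classical_set_scope.

Definition homeomorphism {S T : topologicalType} (f : S -> T) : Prop :=
  exists g : T -> S,
    [/\ cancel f g, cancel g f, continuous f & continuous g].

Definition rectifiable (X : topologicalType) : Prop :=
  exists (e : X) (H : X * X -> X * X),
    [/\ homeomorphism H,
        forall x : X, H (x, e) = (x, x) &
        forall x : X, H @` ([set x] `*` setT) = [set x] `*` setT].

(* X^3 is the left-nested product (X * X) * X. *)
Definition continuously_homogeneous (X : topologicalType) : Prop :=
  exists H : X * X * X -> X * X * X,
    [/\ homeomorphism H,
        forall x y : X, H (x, y, x) = (x, y, y) &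
        forall x y : X, H @` ([set (x, y)] `*` setT) = [set (x, y)] `*` setT].

Definition compact_ideal {X : topologicalType} (I : set (set X)) : Prop :=
  [/\ forall A : set X, I A -> compact A,
      \bigcup_(A in I) A = setT &
      forall A B K : set X, I A -> I B -> compact K ->
        I (A `|` B) /\ I (A `&` K)].

(* [set_type A] is the subset A as a type, with the subspace topology. *)
Definition compact_hausdorff_ideal {X : topologicalType} (I : set (set X)) :
    Prop :=
  compact_ideal I /\ forall A : set X, I A -> hausdorff_space (set_type A).

Definition function_space {X : topologicalType} (I : set (set X))
  (Y : topologicalType) : Type := continuousType X Y.

Section FunctionSpaceTopology.
Context {X : topologicalType} (I : set (set X)) (Y : topologicalType).

Definition subbasic_set (K : set X) (U : set Y) : set (function_space I Y) :=
  [set f : continuousType X Y | f @` K `<=` U].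

Definition function_space_subbase : set (set (function_space I Y)) :=
  [set subbasic_set K U | K in I & U in @open Y].

HB.instance Definition _ := Choice.copy (function_space I Y)
  (continuousType X Y).

HB.instance Definition _ := isSubBaseTopological.Build (function_space I Y)
  function_space_subbase id.

End FunctionSpaceTopology.

Arguments subbasic_set {X} I {Y} K U.
Arguments function_space_subbase {X} I Y.

(* Main.v *)
Require Import Defs.
From mathcomp Require Import all_boot finmap all_classical.
From mathcomp Require Import topology.

(** A homeomorphism of [Y * Y] that preserves every fibre [{x} * Y] has the form
    [(x, y) |-> (x, h (x, y))], and its inverse the form
    [(x, y) |-> (x, k (x, y))].  So rectifiability of [Y] is algebraic
    structure: a point [e] and two continuous binary operations [h], [k] with
    [h (x, k (x, y)) = y = k (x, h (x, y))] and [h (x, e) = x]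
    ([rectifiableP]).  These identities pass to functions pointwise, with the
    constant function [e] as the distinguished point.  What remains is that a
    continuous binary operation on [Y] acts continuously on the function space
    ([continuous_postcompose2]); this uses that a compact Hausdorff [K] in [I]
    has arbitrarily small compact neighbourhoods around each of its points,
    which belong to [I] again.

    Continuous homogeneity follows from the same description: [h (y, k (x, z))],
    as a function of [z], is a homeomorphism taking [x] through [e] to [y],
    and its inverse is obtained by exchanging [x] and [y]. *)

Set Implicit Arguments.
Unset Strict Implicit.
Unset Printing Implicit Defensive.

Local Open Scope classical_set_scope.

Lemma continuous_pair (T Y Z : topologicalType) (f : T -> Y) (g : T -> Z) :
  continuous f -> continuous g -> continuous (fun t => (f t, g t)).
Proof. by move=> cf cg t; apply: cvg_pair; [exact: cf|exact: cg]. Qed.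

Lemma continuous_fst (Y Z : topologicalType) : continuous (@fst Y Z).
Proof. by move=> ?; exact: cvg_fst. Qed.

Lemma continuous_snd (Y Z : topologicalType) : continuous (@snd Y Z).
Proof. by move=> ?; exact: cvg_snd. Qed.

Lemma continuous_compose (T Y Z : topologicalType) (f : T -> Y) (g : Y -> Z) :
  continuous f -> continuous g -> continuous (fun t => g (f t)).
Proof. by move=> cf cg t; apply: continuous_comp; [exact: cf|exact: cg]. Qed.

Lemma fiberwise_homeomorphism (B Z : topologicalType) (p q : B * Z -> Z) :
    continuous p -> continuous q ->
    (forall b z, q (b, p (b, z)) = z) -> (forall b z, p (b, q (b, z)) = z) ->
  homeomorphism (fun w : B * Z => (w.1, p w)) /\
  forall b, (fun w => (w.1, p w)) @` ([set b] `*` setT) = [set b] `*` setT.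
Proof.
move=> cp cq pK qK; split.
  exists (fun w => (w.1, q w)); split.
  - by case=> b z /=; rewrite pK.
  - by case=> b z /=; rewrite qK.
  - by apply: continuous_pair => //; exact: continuous_fst.
  - by apply: continuous_pair => //; exact: continuous_fst.
move=> b; apply/seteqP; split; first by move=> _ [[b' z] [/= -> _] <-].
by move=> [b' z] [/= -> _]; exists (b, q (b, z)); rewrite //= qK.
Qed.

(** The two operations are the second components of the homeomorphism and of
    its inverse; the inverse preserves the fibres because the homeomorphism
    maps each fibre into itself. *)
Lemma rectifiableP (Y : topologicalType) :
  rectifiable Y <->
  exists (e : Y) (h k : Y * Y -> Y),
    [/\ continuous h, continuous k,
        forall x y, k (x, h (x, y)) = y,
        forall x y, h (x, k (x, y)) = y &
        forall x, h (x, e) = x].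
Proof.
split=> [[e [H [[G [HK GK cH cG]] He Hfib]]]|[e [h [k [ch ck hK kK he]]]]].
  have H1 x y : (H (x, y)).1 = x.
    have : ([set x] `*` setT) (H (x, y)) by rewrite -Hfib; exists (x, y).
    by case.
  have G1 x y : (G (x, y)).1 = x.
    by have := GK (x, y); case: (G _) => a b Hab; rewrite -(H1 a b) Hab.
  exists e, (fun w => (H w).2), (fun w => (G w).2); split.
  - by apply: continuous_compose => //; exact: continuous_snd.
  - by apply: continuous_compose => //; exact: continuous_snd.
  - by move=> x y; rewrite -{1}(H1 x y) -surjective_pairing HK.
  - by move=> x y; rewrite -{1}(G1 x y) -surjective_pairing GK.
  - by move=> x; rewrite He.
have [homeoH fibH] := fiberwise_homeomorphism ch ck hK kK.
by exists e, (fun w => (w.1, h w)); split=> // x /=; rewrite he.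
Qed.

Lemma rectifiable_continuously_homogeneous (Y : topologicalType) :
  rectifiable Y -> continuously_homogeneous Y.
Proof.
move=> /rectifiableP[e [h [k [ch ck hK kK he]]]].
have ke x : k (x, x) = e by rewrite -{2}(he x) hK.
pose p (w : Y * Y * Y) := h (w.1.2, k (w.1.1, w.2)).
pose q (w : Y * Y * Y) := h (w.1.1, k (w.1.2, w.2)).
have c11 : continuous (fun w : Y * Y * Y => w.1.1).
  by apply: continuous_compose; exact: continuous_fst.
have c12 : continuous (fun w : Y * Y * Y => w.1.2).
  by apply: continuous_compose; [exact: continuous_fst|exact: continuous_snd].
have c2 : continuous (fun w : Y * Y * Y => w.2) by exact: continuous_snd.
have [||||homeoH fibH] := @fiberwise_homeomorphism (Y * Y)%type Y p q.
- apply: continuous_compose ch; apply: continuous_pair => //.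
  by apply: continuous_compose ck; exact: continuous_pair.
- apply: continuous_compose ch; apply: continuous_pair => //.
  by apply: continuous_compose ck; exact: continuous_pair.
- by case=> x y z; rewrite /p /q /= hK kK.
- by case=> x y z; rewrite /p /q /= hK kK.
exists (fun w => (w.1, p w)); split=> // x y.
by rewrite /p /= ke he.
Qed.

(** The inclusion of [set_type K] transports near coverings: a property near a
    point of the subspace becomes one that holds near that point of [X] for
    those points that lie in [K]. *)
Lemma compact_set_type (X : topologicalType) (K : set X) :
  compact K -> compact [set: set_type K].
Proof.
move=> /compact_near_coveringP/near_covering_withinP Kc.
apply/compact_near_coveringP => J F P FF cover.
have : \forall i \near F,
    K `<=` (fun x => forall Kx : x \in K, P i (exist _ x Kx)).
  apply: Kc => x /mem_set Kx.
  have [[A B] /= [xA FB] ABP] := cover (exist _ x Kx) Logic.I.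
  move: xA => [_ [[W oW <-] Wx sWA]].
  exists (W, B) => /=; first by split => //; exact: open_nbhs_nbhs.
  move=> [y i] /= [Wy Bi] _ Ky; apply: (ABP (exist _ y Ky, i)).
  by split => //; apply: sWA.
by apply: filterS => i KP [x Kx] _; apply: KP; exact: set_mem.
Qed.

(** [X] itself need not be regular, but the subspace [K] is, being compact
    Hausdorff: [C] is the image of a closed neighbourhood of [x] in [K]. *)
Lemma compact_hausdorff_shrink (X : topologicalType) (K O : set X) (x : X) :
    compact K -> hausdorff_space (set_type K) -> K x -> nbhs x O ->
  exists2 C : set X, compact C /\ C `<=` K `&` O &
    \forall y \near x, K y -> C y.
Proof.
move=> Kc Kh /mem_set Kx xO.
have cval : continuous (set_val : set_type K -> X).
  exact: initial_continuous.
have KcT := compact_set_type Kc.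
pose kx : set_type K := exist _ x Kx.
have [D xD DO] :=
  compact_regular Kh KcT (filterT : nbhs kx setT) (cval kx _ xO).
exists (set_val @` closure D); first split.
- apply: continuous_compact; first exact: continuous_subspaceT.
  by apply: subclosed_compact KcT _ => //; exact: closed_closure.
- by move=> _ [[y Ky] /DO Oy <-]; split => //; exact: set_mem.
move: xD => [_ [[W oW <-] Wx sWD]].
have : nbhs x W by exact: open_nbhs_nbhs.
apply: filterS => y Wy /mem_set Ky.
by exists (exist _ y Ky) => //; apply: subset_closure; exact: sWD.
Qed.

Section FunctionSpace.
Context {X : topologicalType} (I : set (set X)).

(** The witnesses build [subbasic_set I K U] as an open set of the generated
    topology: a union of one intersection of one member of the subbase. *)
Lemma nbhs_subbasic_set (Y : topologicalType) (K : set X) (U : set Y)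
    (f : function_space I Y) :
  I K -> open U -> subbasic_set I K U f -> nbhs f (subbasic_set I K U).
Proof.
move=> IK oU fKU; exists (subbasic_set I K U); split => //.
exists [set subbasic_set I K U]; last by rewrite bigcup_set1.
move=> _ ->; exists [fset subbasic_set I K U]%fset.
  by move=> S /fset1P ->; rewrite inE; exists K => //; exists U.
by rewrite set_fset1 bigcap_set1.
Qed.

(** Preimages commute with the finite intersections and the unions that
    generate the topology, so the subbase suffices to test continuity. *)
Lemma continuous_to_function_space (S Y : topologicalType)
    (F : S -> function_space I Y) :
  (forall s K U, I K -> open U -> subbasic_set I K U (F s) ->
     \forall t \near s, subbasic_set I K U (F t)) ->
  continuous F.
Proof.
move=> cF s A [_ [[D sD <-] [B DB Bs] sDA]].
apply: filterS (fun t Bt => sDA _ (ex_intro2 _ _ B DB Bt)) _.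
have [E sE EB] := sD _ DB; move: Bs; rewrite -EB => Es.
apply: (@filter_bigI _ _ _ (fun V => F @^-1` V)) => V EV.
have := sE _ EV; rewrite inE => -[K IK [U oU KUV]].
have := Es _ EV; rewrite /= -KUV; exact: cF.
Qed.

Definition postcompose2 (Y Z T : topologicalType) (phi : Y * Z -> T)
    (cphi : continuous phi) (t : function_space I Y * function_space I Z) :
    function_space I T :=
  mkcts (continuous_compose (continuous_pair
    (@cts_fun _ _ (t.1 : continuousType X Y))
    (@cts_fun _ _ (t.2 : continuousType X Z))) cphi).

(** This is where the Hausdorff hypothesis enters.  A pair of subbasic
    neighbourhoods over the whole of [K] will not do in general: a box
    [U `*` V] containing all pairs [(f x, g x)], [x] in [K], may be too large
    for [phi] to map it into [W].  Around each [x] a small box works, and by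
    [compact_hausdorff_shrink] it works on a compact neighbourhood [C] of [x]
    in [K]; this [C] is again in [I], so [subbasic_set I C U] and
    [subbasic_set I C V] are open.  Compactness of [K], as a near
    covering property, then makes the neighbourhood of [(f, g)] uniform in
    [x]. *)
Lemma continuous_postcompose2 (hI : compact_hausdorff_ideal I)
    (Y Z T : topologicalType) (phi : Y * Z -> T) (cphi : continuous phi) :
  continuous (postcompose2 cphi).
Proof.
have [[Icompact _ IUI] Ihausdorff] := hI.
apply: continuous_to_function_space => -[f g] K W IK oW KW.
have /compact_near_coveringP/near_covering_withinP Kc := Icompact _ IK.
pose P t x := W ((postcompose2 cphi t : continuousType X T) x).
pose F : set_system (function_space I Y * function_space I Z) := nbhs (f, g).
have FF : Filter F by exact: filter_prod_filter.
have : \forall t \near F, K `<=` P t.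
  apply: (Kc _ F P FF) => x Kx.
  have Wx : P (f, g) x by apply: KW; exists x.
  have [[U V] /= [fU gV] UVW] := cphi _ _ (open_nbhs_nbhs (conj oW Wx)).
  move: fU gV; rewrite !nbhsE => -[U' [oU U'f] sU] [V' [oV V'g] sV].
  have xO : nbhs x ((f : continuousType X Y) @^-1` U' `&`
                    (g : continuousType X Z) @^-1` V').
    by apply: filterI; apply: cts_fun; exact: open_nbhs_nbhs.
  have [C [Cc CKO] xC] :=
    compact_hausdorff_shrink (Icompact _ IK) (Ihausdorff _ IK) Kx xO.
  have IC : I C.
    have [_] := IUI _ _ _ IK IK Cc.
    by rewrite setIidr // => y /CKO[].
  have nearf : nbhs f (subbasic_set I C U').
    by apply: nbhs_subbasic_set => // _ [y /CKO[_ []] ? _ <-].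
  have nearg : nbhs g (subbasic_set I C V').
    by apply: nbhs_subbasic_set => // _ [y /CKO[_ []] _ ? <-].
  have nearfg : nbhs (f, g) (subbasic_set I C U' `*` subbasic_set I C V').
    by exists (subbasic_set I C U', subbasic_set I C V').
  exists ([set y | K y -> C y],
          subbasic_set I C U' `*` subbasic_set I C V').
    by split; [exact: xC|exact: nearfg].
  move=> [y [f' g']] /= [yC [f'U g'V]] /yC Cy; apply: UVW; split.
    by apply/sU/f'U; exists y.
  by apply/sV/g'V; exists y.
by apply: filterS => -[f' g'] /= KW' _ [x Kx <-]; exact: (KW' x Kx).
Qed.

End FunctionSpace.

Theorem corollary4p4 (X : topologicalType) (I : set (set X))
    (hI : compact_hausdorff_ideal I)
    (Y : topologicalType) (hY : rectifiable Y) :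
  rectifiable (function_space I Y) /\
  continuously_homogeneous (function_space I Y).
Proof.
suff rect : rectifiable (function_space I Y).
  by split; last exact: rectifiable_continuously_homogeneous.
move: hY => /rectifiableP[e [h [k [ch ck hK kK he]]]].
apply/rectifiableP.
exists (cst e : continuousType X Y), (postcompose2 ch), (postcompose2 ck).
split.
- exact: continuous_postcompose2.
- exact: continuous_postcompose2.
- by move=> f g; apply/continuousEP => x; exact: hK.
- by move=> f g; apply/continuousEP => x; exact: kK.
- by move=> f; apply/continuousEP => x; exact: he.
Qed.
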